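(* Let $L\subset\mathbb{Z}^n$ be a lattice. The set of equivalence classes of Markov fibers of the lattice ideal $I_L$ is an invariant of $I_L$; that is, the set $\{\overline{F_B}:B\in S\}$ is the same for every cardinality-minimal generating set $S$ of $I_L$.
   Context: Let $\Bbbk$ be a field, $\mathbb{N}=\mathbb{Z}_{\ge0}$. A lattice is a subgroup $L\subset\mathbb{Z}^n$; its lattice ideal is $I_L=\langle x^u-x^v:u,v\in\mathbb{N}^n,\ u-v\in L\rangle\subset\Bbbk[x_1,\ldots,x_n]$. A binomial means a difference $x^u-x^v$ of two distinct monomials. A minimal generating set of $I_L$ is a set of binomials that is a minimal (under inclusion) system of generators of $I_L$; it is a cardinality-minimal generating set if it has the least cardinality among all minimal generating sets. An $I_L$-fiber is a set of the form $F_u=\{x^v:v\in\mathbb{N}^n,\ v-u\in L\}$ with $u\in\mathbb{N}^n$. For a binomial $B=x^u-x^v\in I_L$, $F_B:=F_u=F_v$. Fibers $F,G$ are equivalent if there are $u,v\in\mathbb{N}^n$ with $x^uF\subset G$ and $x^vG\subset F$; $\overline F$ denotes the equivalence class of $F$. An $I_L$-fiber $F$ is a Markov fiber if there is a cardinality-minimal generating set $S$ of $I_L$ and $B\in S$ with $\overline{F_B}=\overline F$. *)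

(* Defs.v *)
From mathcomp Require Import all_boot all_order all_algebra.
From mathcomp Require Import boolp classical_sets functions cardinality.
From mathcomp Require Import mpoly.

Set Implicit Arguments.
Unset Strict Implicit.
Unset Printing Implicit Defensive.

Import GRing.Theory.

Local Open Scope ring_scope.
Local Open Scope classical_set_scope.
Local Open Scope card_scope.

Definition ideal_gen (R : comNzRingType) (G : set R) : set R :=
  [set p | exists s : seq (R * R),
     (forall c, c \in s -> G c.2) /\ p = \sum_(c <- s) c.1 * c.2].

(* Exponent vectors u, v \in N^n are identified with the monomials
   x^u, x^v : 'X_{1..n}, whose product is written additively; 'X_[u] is the
   monomial x^u seen as a polynomial. *)

(* The vector u - v, with subtraction in Z^n (mnmB on 'X_{1..n} truncates). *)
Definition expdiff n (u v : 'X_{1..n}) : 'rV[int]_n :=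
  \row_(i < n) ((u i)%:Z - (v i)%:Z).

Section Lattice.
Variables (n : nat) (L : zmodClosed 'rV[int]_n).

Definition fiber (u : 'X_{1..n}) : set 'X_{1..n} :=
  [set v | expdiff v u \in L].

Definition is_fiber (F : set 'X_{1..n}) : Prop := exists u, F = fiber u.

Definition fiber_equiv (F G : set 'X_{1..n}) : Prop :=
  exists u v : 'X_{1..n},
    [set (u + m)%MM | m in F] `<=` G /\ [set (v + m)%MM | m in G] `<=` F.

Definition fiber_class (F : set 'X_{1..n}) : set (set 'X_{1..n}) :=
  [set G | is_fiber G /\ fiber_equiv F G].

Section Ideal.
Variable k : fieldType.
Implicit Types (B : {mpoly k[n]}) (S T : set {mpoly k[n]}).

Definition lattice_ideal : set {mpoly k[n]} :=
  ideal_gen [set p | exists u v : 'X_{1..n},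
                       expdiff u v \in L /\ p = 'X_[u] - 'X_[v]].

Definition binomial : set {mpoly k[n]} :=
  [set B | exists u v : 'X_{1..n}, u != v /\ B = 'X_[u] - 'X_[v]].

Definition minimal_generating_set S : Prop :=
  [/\ S `<=` binomial,
      ideal_gen S = lattice_ideal
    & forall T, T `<=` S -> ideal_gen T = lattice_ideal -> T = S].

Definition card_minimal_generating_set S : Prop :=
  minimal_generating_set S /\
  forall T, minimal_generating_set T -> S #<= T.

(* F_B = F_u for B = x^u - x^v. A union over the ways of writing B as such a
   difference: in characteristic 2 there are two of them, x^u - x^v and
   x^v - x^u, which give the same fiber when B is in the lattice ideal. *)
Definition binomial_fiber B : set 'X_{1..n} :=
  [set w | exists u v : 'X_{1..n},
     [/\ u != v, B = 'X_[u] - 'X_[v] & fiber u w]].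

Definition markov_fiber (F : set 'X_{1..n}) : Prop :=
  is_fiber F /\
  exists S B, [/\ card_minimal_generating_set S, S B
                & fiber_class (binomial_fiber B) = fiber_class F].

Definition markov_fiber_classes : set (set (set 'X_{1..n})) :=
  [set fiber_class F | F in markov_fiber].

Definition binomial_fiber_classes S : set (set (set 'X_{1..n})) :=
  [set fiber_class (binomial_fiber B) | B in S].

End Ideal.
End Lattice.

(* Main.v *)
Require Import Defs.
From HB Require Import structures.
From mathcomp Require Import all_boot all_order all_algebra.
From mathcomp Require Import boolp classical_sets functions cardinality.
From mathcomp Require Import mpoly.

(** The ideal I_L is graded by the fibers, i.e. by N^n modulo congruence
    along L. Taking the component of degree F_B in an expression of a binomial
    B in terms of generators shows that only generators whose fiber can be
    shifted into F_B matter (lemma [homog_below]). Shifting preorders the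
    fibers, and the induced equivalence is the one of the statement.

    Let S and T be minimal generating sets, and suppose that B in S has a fiber
    class c that no element of T has. Then B lies in the ideal generated by the
    elements of T of class at most c, hence strictly below c; each of these lies
    in the ideal generated by the elements of S of class strictly below c. None
    of the latter is B, so B is redundant in S, against minimality. Thus any two
    inclusion-minimal generating sets have the same fiber classes (lemma
    [minimal_classes_subset]), and so do the cardinality-minimal ones. *)

Set Implicit Arguments.
Unset Strict Implicit.
Unset Printing Implicit Defensive.

Import GRing.Theory.

Local Open Scope ring_scope.
Local Open Scope classical_set_scope.

(** * Ideals generated by a set *)

Section IdealGen.
Variable R : comNzRingType.
Implicit Types (G H : set R) (p q : R).

Lemma ideal_gen_sub G : G `<=` ideal_gen G.
Proof.
move=> p Gp; exists [:: (1, p)]; split; last by rewrite big_seq1 mul1r.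
by move=> c; rewrite inE => /eqP->.
Qed.

Lemma ideal_gen0 G : ideal_gen G 0.
Proof. by exists [::]; split=> //; rewrite big_nil. Qed.

Lemma ideal_genD G p q : ideal_gen G p -> ideal_gen G q -> ideal_gen G (p + q).
Proof.
move=> [s [Gs ->]] [t [Gt ->]]; exists (s ++ t); split; last by rewrite big_cat.
by move=> c; rewrite mem_cat => /orP[/Gs|/Gt].
Qed.

Lemma ideal_genMl G q p : ideal_gen G p -> ideal_gen G (q * p).
Proof.
move=> [s [Gs ->]]; exists [seq (q * c.1, c.2) | c <- s]; split.
  by move=> c /mapP[d /Gs Gd ->].
by rewrite big_map mulr_sumr; apply: eq_bigr => c _; rewrite mulrA.
Qed.

Lemma ideal_gen_sum G (I : eqType) (r : seq I) (P : pred I) (F : I -> R) :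
    (forall i, i \in r -> P i -> ideal_gen G (F i)) ->
  ideal_gen G (\sum_(i <- r | P i) F i).
Proof.
move=> GF; rewrite big_seq_cond; elim/big_rec: _ => [|i p /andP[ri Pi] Gp].
  exact: ideal_gen0.
by apply: ideal_genD => //; apply: GF.
Qed.

Lemma ideal_gen_subset G H : G `<=` ideal_gen H -> ideal_gen G `<=` ideal_gen H.
Proof.
move=> GH _ [s [Gs ->]]; apply: ideal_gen_sum => c /Gs Gc _.
by apply: ideal_genMl; apply: GH.
Qed.

End IdealGen.

(** * Congruence along the lattice and the shift preorder *)

Section Lattice.
Variables (n : nat) (L : zmodClosed 'rV[int]_n).
Implicit Types (u v w a b m : 'X_{1..n}) (F G H : set 'X_{1..n}).

Definition congruent u v := expdiff u v \in L.

Lemma congruent_refl u : congruent u u.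
Proof.
rewrite /congruent (_ : expdiff u u = 0) ?rpred0 //.
by apply/rowP => i; rewrite !mxE subrr.
Qed.

Lemma congruent_sym u v : congruent u v = congruent v u.
Proof.
rewrite /congruent -rpredN (_ : - expdiff u v = expdiff v u) //.
by apply/rowP => i; rewrite !mxE opprB.
Qed.

Lemma congruent_trans v u w : congruent u v -> congruent v w -> congruent u w.
Proof.
rewrite /congruent => uv vw.
rewrite (_ : expdiff u w = expdiff u v + expdiff v w) ?rpredD //.
by apply/rowP => i; rewrite !mxE addrA subrK.
Qed.

Lemma congruentDl w u v : congruent (w + u)%MM (w + v)%MM = congruent u v.
Proof.
rewrite /congruent (_ : expdiff _ _ = expdiff u v) //; apply/rowP => i.
by rewrite !mxE !mnmDE !PoszD opprD addrACA subrr add0r.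
Qed.

(** Some translate of the fiber of u is contained in the fiber of v. *)
Definition fiber_le u v := exists w, congruent (w + u)%MM v.

Lemma fiber_le_congr u u' v : congruent u u' -> fiber_le u v -> fiber_le u' v.
Proof.
move=> uu' [w wuv]; exists w; apply: congruent_trans wuv.
by rewrite congruentDl congruent_sym.
Qed.

Lemma fiber_equiv_sym F G : fiber_equiv F G -> fiber_equiv G F.
Proof. by move=> [u [v [FG GF]]]; exists v, u. Qed.

Lemma fiber_equiv_trans F G H :
  fiber_equiv F G -> fiber_equiv G H -> fiber_equiv F H.
Proof.
move=> [u [v [FG GF]]] [u' [v' [GH HG]]].
exists (u' + u)%MM, (v + v')%MM; split=> _ [m mF <-].
  by rewrite -addmA; apply: GH; exists (u + m)%MM => //; apply: FG; exists m.
by rewrite -addmA; apply: GF; exists (v' + m)%MM => //; apply: HG; exists m.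
Qed.

Lemma fiber_class_eq u v :
  fiber_le u v -> fiber_le v u ->
  fiber_class L (fiber L u) = fiber_class L (fiber L v).
Proof.
move=> [w wuv] [w' w'vu].
have uv : fiber_equiv (fiber L u) (fiber L v).
  exists w, w'; split=> _ [m mu <-].
    by apply: congruent_trans wuv; rewrite congruentDl.
  by apply: congruent_trans w'vu; rewrite congruentDl.
apply/seteqP; split=> G [fG eG]; split=> //; apply: fiber_equiv_trans eG => //.
exact: fiber_equiv_sym.
Qed.

(** * The grading of the polynomial ring by fibers *)

Variable k : fieldType.
Implicit Types (p q B : {mpoly k[n]}) (S T : set {mpoly k[n]}).

Definition fiber_part a p : {mpoly k[n]} :=
  \sum_(m <- msupp p | congruent m a) p@_m *: 'X_[m].

Lemma mcoeff_fiber_part a p m :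
  (fiber_part a p)@_m = if congruent m a then p@_m else 0.
Proof.
rewrite /fiber_part raddf_sum /=.
under eq_bigr => m' _ do rewrite mcoeffZ mcoeffX.
have [pm|pm] := boolP (m \in msupp p).
  rewrite big_mkcond (bigD1_seq m) ?msupp_uniq //= eqxx mulr1 big1 ?addr0 //.
  by move=> m' /negPf->; rewrite mulr0 if_same.
rewrite (memN_msupp_eq0 pm) if_same big_seq_cond big1 // => m' /andP[pm' _].
by case: eqP pm' pm => [-> ->//|]; rewrite mulr0.
Qed.

Lemma fiber_part_is_linear a : linear (fiber_part a).
Proof.
move=> c p q; apply/mpolyP => m.
rewrite mcoeffD mcoeffZ !mcoeff_fiber_part mcoeffD mcoeffZ.
by case: ifP => // _; rewrite mulr0 addr0.
Qed.

HB.instance Definition _ a :=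
  GRing.isLinear.Build k {mpoly k[n]} {mpoly k[n]} *:%R (fiber_part a)
    (fiber_part_is_linear a).

Lemma fiber_partX a u :
  fiber_part a 'X_[u] = if congruent u a then 'X_[u] else 0.
Proof.
apply/mpolyP => m; rewrite mcoeff_fiber_part mcoeffX.
case: (u =P m) => [<-|/eqP/negPf um].
  by case: ifP; rewrite ?mcoeffX ?eqxx ?mcoeff0.
by rewrite if_same; case: ifP; rewrite ?mcoeffX ?um ?mcoeff0.
Qed.

Definition fiber_homog p := {in msupp p &, forall u v, congruent u v}.

Lemma fiber_homog_difference u v :
  congruent u v -> fiber_homog ('X_[u] - 'X_[v]).
Proof.
have suppP m : m \in msupp ('X_[u] - 'X_[v] : {mpoly k[n]}) -> m = u \/ m = v.
  move/msuppB_le; rewrite mem_cat !msuppX !inE.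
  by case/orP=> /eqP->; [left | right].
move=> uv a b /suppP[]-> /suppP[]->; rewrite ?congruent_refl //.
by rewrite congruent_sym.
Qed.

Lemma fiber_part_mulX a m p : fiber_homog p ->
  (exists2 u, u \in msupp p & congruent (m + u)%MM a) /\
    fiber_part a ('X_[m] * p) = 'X_[m] * p
  \/ fiber_part a ('X_[m] * p) = 0.
Proof.
move=> hom_p.
have [[u pu mua]|none] := EM (exists2 u, u \in msupp p & congruent (m + u)%MM a).
  left; split; first by exists u.
  rewrite {1 2}[p]mpolyE mulr_sumr raddf_sum /= big_seq [RHS]big_seq.
  apply: eq_bigr => v pv; rewrite -scalerAr -mpolyXD linearZ /= fiber_partX.
  by rewrite (congruent_trans _ mua) // congruentDl hom_p.
right; rewrite {1}[p]mpolyE mulr_sumr raddf_sum /= big_seq big1 // => v pv.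
rewrite -scalerAr -mpolyXD linearZ /= fiber_partX ifN ?scaler0 //.
by apply/negP => mva; apply: none; exists v.
Qed.

(** The shift preorder is tested on exponents in the support rather than on
    [binomial_fiber], so that it makes sense for arbitrary homogeneous
    generators, the possibly zero differences that define I_L included. *)
Definition below a T : set {mpoly k[n]} :=
  [set B | T B /\ exists2 u, u \in msupp B & fiber_le u a].

(** For B homogeneous of degree the fiber of u, the multiple x^m B is
    homogeneous of degree the fiber of m + u, so it survives in degree a only
    if x^m moves the fiber of u into that of a. *)
Lemma fiber_part_ideal a T p : (forall B, T B -> fiber_homog B) ->
  ideal_gen T p -> ideal_gen (below a T) (fiber_part a p).
Proof.
move=> Thom [s [Ts ->]]; rewrite raddf_sum /=.
apply: ideal_gen_sum => -[q B] /Ts /= TB _.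
rewrite [q]mpolyE mulr_suml raddf_sum /=.
apply: ideal_gen_sum => m _ _; rewrite -scalerAl linearZ /= -mul_mpolyC.
apply: ideal_genMl.
have [[[u Bu mua] ->]|->] := fiber_part_mulX a m (Thom _ TB).
  by apply/ideal_genMl/ideal_gen_sub; split=> //; exists u => //; exists m.
exact: ideal_gen0.
Qed.

(** A homogeneous p is its own component in the degree of any of its exponents,
    so generators whose fiber cannot be shifted into that degree drop out. *)
Lemma homog_below u T p : (forall B, T B -> fiber_homog B) ->
    fiber_homog p -> u \in msupp p ->
  ideal_gen T p -> ideal_gen (below u T) p.
Proof.
move=> Thom hom_p pu /(fiber_part_ideal u Thom).
have := fiber_part_mulX u 0%MM hom_p; rewrite mpolyX0 mul1r.
case=> [[_ ->//]|p0]; suff : u \in msupp (fiber_part u p) by rewrite p0 msupp0.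
by rewrite mcoeff_msupp mcoeff_fiber_part congruent_refl -mcoeff_msupp.
Qed.

(** If u and v were not congruent, x^u would be the component of x^u - x^v in
    the degree of u, hence would lie in I_L; but all of I_L vanishes at
    (1, ..., 1). *)
Lemma lattice_ideal_congruent u v :
  lattice_ideal L ('X_[u] - 'X_[v] : {mpoly k[n]}) -> congruent u v.
Proof.
move=> ILuv; apply: contrapT => /negP; rewrite congruent_sym => /negPf vu.
have meval1X m : meval (fun=> 1) 'X_[m] = 1 :> k.
  by rewrite mevalX big1 // => i _; rewrite expr1n.
move: ILuv => /(fiber_part_ideal u); rewrite raddfB /= !fiber_partX.
rewrite congruent_refl vu subr0.
case=> [B [a [b [ab ->]]]|s [sP]]; first exact: fiber_homog_difference.
move/(congr1 (meval (fun=> 1))); rewrite meval1X raddf_sum big_seq big1 /=.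
  by move/eqP; rewrite oner_eq0.
move=> c /sP [[a [b [_ ->]]] _].
by rewrite mevalM mevalB !meval1X subrr mulr0.
Qed.

(** * Fiber classes of minimal generating sets *)

(** True in characteristic 2 as well, where u and v are only determined up to
    exchange: the coefficients 1 and -1 are nonzero at distinct exponents. *)
Lemma msupp_binomial u v m : u != v ->
  (m \in msupp ('X_[u] - 'X_[v] : {mpoly k[n]})) = (m == u) || (m == v).
Proof.
rewrite mcoeff_msupp mcoeffB !mcoeffX => neq_uv.
rewrite [m == u]eq_sym [m == v]eq_sym.
have [um|_] := eqVneq u m; have [vm|_] := eqVneq v m.
- by move: neq_uv; rewrite um vm eqxx.
- by rewrite subr0 oner_neq0.
- by rewrite sub0r oppr_eq0 oner_neq0.
- by rewrite subr0 eqxx.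
Qed.

Lemma binomial_fiberE B u : Defs.binomial B -> fiber_homog B -> u \in msupp B ->
  binomial_fiber L B = fiber L u.
Proof.
move=> [a [b [neq_ab eB]]] homB Bu; apply/seteqP; split=> w.
  move=> [a' [b' [neq_ab' eB' wa']]]; apply: congruent_trans wa' _.
  by apply: homB => //; rewrite eB' msupp_binomial // eqxx.
move=> wu; exists a, b; split=> //; apply: congruent_trans wu _.
by apply: homB => //; rewrite eB msupp_binomial // eqxx.
Qed.

Lemma generator_homog S B :
    S `<=` @Defs.binomial n k -> ideal_gen S = @lattice_ideal n L k -> S B ->
  fiber_homog B.
Proof.
move=> Sbin Sgen SB; have [u [v [_ eB]]] := Sbin _ SB.
rewrite eB; apply/fiber_homog_difference/lattice_ideal_congruent.
by rewrite -eB -Sgen; apply: ideal_gen_sub.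
Qed.

Lemma binomial_msupp B : Defs.binomial B -> exists u, u \in msupp B.
Proof. by move=> [u [v [uv ->]]]; exists u; rewrite msupp_binomial // eqxx. Qed.

(** If no element of T had the class of B, then B would be a combination of
    elements of T of strictly smaller class, hence of elements of S of strictly
    smaller class, among which B does not occur. *)
Lemma minimal_classes_subset S T :
    minimal_generating_set L S -> minimal_generating_set L T ->
  binomial_fiber_classes L S `<=` binomial_fiber_classes L T.
Proof.
move=> [Sbin Sgen Smin] [Tbin Tgen _] _ [B SB <-].
have Shom C := @generator_homog S C Sbin Sgen.
have Thom C := @generator_homog T C Tbin Tgen.
have [u Bu] := binomial_msupp (Sbin _ SB).
apply: contrapT => noT.
suff Bred : ideal_gen (S `\ B) B.
  have eS : S `\ B = S.
    apply: Smin => [C []//|]; rewrite -Sgen; apply/seteqP; split.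
      by apply: ideal_gen_subset => C [SC _]; apply: ideal_gen_sub.
    apply: ideal_gen_subset => C SC.
    by have [->//|neqCB] := EM (C = B); apply: ideal_gen_sub; split.
  by move: SB; rewrite -eS => -[_]; apply.
have : ideal_gen T B by rewrite Tgen -Sgen; apply: ideal_gen_sub.
move/(homog_below Thom (Shom _ SB) Bu).
apply: ideal_gen_subset => C [TC [a Ca le_au]].
(* otherwise C and B would have the same class *)
have nle_ua : ~ fiber_le u a.
  move=> le_ua; apply: noT; exists C => //.
  rewrite (binomial_fiberE (Tbin _ TC) (Thom _ TC) Ca).
  rewrite (binomial_fiberE (Sbin _ SB) (Shom _ SB) Bu).
  exact: fiber_class_eq.
have : ideal_gen S C by rewrite Sgen -Tgen; apply: ideal_gen_sub.
move/(homog_below Shom (Thom _ TC) Ca).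
apply: ideal_gen_subset => D [SD [d Dd le_da]].
apply: ideal_gen_sub; split=> // eDB; apply: nle_ua.
apply: fiber_le_congr le_da; apply: (Shom _ SB) => //.
by rewrite -eDB.
Qed.

Lemma minimal_classes_eq S T :
    minimal_generating_set L S -> minimal_generating_set L T ->
  binomial_fiber_classes L S = binomial_fiber_classes L T.
Proof. by move=> mS mT; apply/seteqP; split; apply: minimal_classes_subset. Qed.

End Lattice.

Theorem corollary3p14 (k : fieldType) (n : nat)
    (L : zmodClosed 'rV[int]_n) (S S' : set {mpoly k[n]}) :
  card_minimal_generating_set L S ->
  card_minimal_generating_set L S' ->
  binomial_fiber_classes L S = binomial_fiber_classes L S' /\
  markov_fiber_classes L k = binomial_fiber_classes L S.
Proof.
move=> cS [mS' _]; have [mS _] := cS.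
split; first exact: minimal_classes_eq.
apply/seteqP; split=> [_ [F [_ [T [B [[mT _] TB <-]]]] <-]|_ [B SB <-]].
  by rewrite (minimal_classes_eq mS mT); exists B.
exists (binomial_fiber L B) => //; split; last by exists S, B.
have [Sbin Sgen _] := mS.
have [u Bu] := binomial_msupp (Sbin _ SB).
exists u; apply: binomial_fiberE => //; first exact: Sbin.
exact: generator_homog Sbin Sgen SB.
Qed.
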